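(* Let $\mathcal H$ be a real Hilbert space and $\gamma>0$. Assume: (a) $\Phi:\mathcal H\to\mathbb R$ is convex and differentiable, $\nabla\Phi$ is Lipschitz continuous on bounded subsets of $\mathcal H$, and $C:=\operatorname{argmin}\Phi=\Phi^{-1}(0)\neq\emptyset$ (so $\min_{\mathcal H}\Phi=0$); (b) $\Psi:\mathcal H\to\mathbb R$ is convex and differentiable, $\nabla\Psi$ is Lipschitz continuous on bounded subsets of $\mathcal H$, and $\Psi$ is bounded from below; (c) $S:=\operatorname{argmin}_C\Psi=\{z\in C:\Psi(z)=\min_C\Psi\}$ is nonempty; (d) $\epsilon:[0,+\infty[\to]0,+\infty[$ is nonincreasing, of class $C^1$, and $\epsilon(t)\to0$, $\dot\epsilon(t)\to0$ as $t\to+\infty$; (H1) $\int_0^{+\infty}\epsilon(t)\,dt=+\infty$. Assume that $\Psi$ is uniformly convex in the following sense: there exists a function $\theta:\mathbb R_+\to\mathbb R_+$ such that $\theta(t_n)\to0$ implies $t_n\to0$ (for every sequence $(t_n)$ in $\mathbb R_+$) and, for all $x,y\in\mathcal H$, $$\langle\nabla\Psi(x)-\nabla\Psi(y),x-y\rangle\ge\theta(\|x-y\|).$$ Let $x_\infty$ be the unique point of $S$. Assume that one of the following two conditions holds: (i) the set $\{x\in\mathcal H:\langle\nabla\Psi(x),x-x_\infty\rangle\le0\}$ is weakly compact; (ii) both (H2) and (H3) hold, where (H2) for every $p\in\mathcal C$, $\int_0^{+\infty}\left[\Phi^*(\epsilon(t)p)-\sigma_C(\epsilon(t)p)\right]dt<+\infty$,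 with $$\mathcal C=\{\lambda p:\ \lambda\ge0,\ \exists z\in C,\ p=-\nabla\Psi(z),\ \nabla\Psi(z)+N_C(z)\ni0\};$$ (H3) there is a constant $k>0$ such that $0\le-\dot\epsilon(t)\le k\,\epsilon^2(t)$ for all large $t$. Let $x$ be a classical maximal solution of $$\ddot x(t)+\gamma\dot x(t)+\nabla\Phi(x(t))+\epsilon(t)\nabla\Psi(x(t))=0.$$ Then $\lim_{t\to+\infty}\|x(t)-x_\infty\|=0$.
   Context: $\Phi^*(y)=\sup_{x\in\mathcal H}\{\langle y,x\rangle-\Phi(x)\}$ is the Fenchel conjugate of $\Phi$; $\sigma_C(y)=\sup_{x\in C}\langle y,x\rangle$ is the support function of $C$; $N_C(z)=\{q\in\mathcal H:\langle q,y-z\rangle\le0\ \ \forall y\in C\}$ is the outward normal cone to $C$ at $z\in C$. A maximal solution starts at time $t=0$ from arbitrary Cauchy data $(x(0),\dot x(0))\in\mathcal H\times\mathcal H$ and cannot be extended to a larger interval $[0,T[$; under assumptions (a)-(d) every maximal solution is defined on $[0,+\infty[$. The paper attributes case (i) to earlier work (Attouch–Czarnecki, and its generalization by Cabot) and refers to it for the proof. *)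

(* Defs.v *)
From HB Require Import structures.
From mathcomp Require Import all_boot all_order all_algebra.
From mathcomp Require Import all_classical all_reals all_analysis.

Set Implicit Arguments.
Unset Strict Implicit.
Unset Printing Implicit Defensive.

Import Order.TTheory GRing.Theory Num.Theory.
Import numFieldNormedType.Exports.

Local Open Scope classical_set_scope.
Local Open Scope ring_scope.

Section Hilbert.
Context {R : realType} {H : normedModType R}.
Implicit Types (A C : set H) (f : H -> R) (g : H -> H).

(* A [completeNormedModType R] with an inner product inducing its norm is a
   real Hilbert space. *)
Definition norm_induced_by (dot : {dot H for idfun}) :=
  forall x : H, `|x| ^+ 2 = dot x x.

Variable dot : {dot H for idfun}.

(* [g] is the gradient of the Fréchet differentiable function [f]: it represents
   the differential through the inner product, which determines it uniquely. *)
Definition is_gradient f g :=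
  forall x, differentiable f x /\ forall h, 'd f x h = dot (g x) h.

Definition lipschitz_on_bounded g :=
  forall B : set H, bounded_set B -> [lipschitz g x | x in B].

Definition argmin A f : set H := [set z | A z /\ forall y, A y -> f z <= f y].

Definition fenchel_conjugate f (y : H) : \bar R :=
  ereal_sup [set (dot y x - f x)%:E | x in [set: H]].

Definition support_function C (y : H) : \bar R :=
  ereal_sup [set (dot y x)%:E | x in C].

Definition normal_cone C (z : H) : set H :=
  [set q | forall y, C y -> dot q (y - z) <= 0].

Definition multiplier_cone C g : set H :=
  [set v | exists lambda p, [/\ 0 <= lambda, v = lambda *: p &
    exists z, [/\ C z, p = - g z &
      exists2 q, normal_cone C z q & g z + q = 0]]].

(* Uniform convexity of a differentiable function with gradient [g]; only the
   restriction of [theta] to the nonnegative reals matters. *)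
Definition uniformly_monotone g :=
  exists theta : R -> R,
    [/\ forall t : R, 0 <= t -> 0 <= theta t,
        forall u : R^nat, (forall n, 0 <= u n) ->
          theta (u n) @[n --> \oo] --> (0 : R) -> u @ \oo --> (0 : R) &
        forall x y, theta `|x - y| <= dot (g x - g y) (x - y)].

(* [H] with the coarsest topology making all its continuous linear functionals
   continuous. *)
Definition weak_topology : topologicalType :=
  sup_topology (fun phi : {phi : {linear H -> R^o} | continuous phi} =>
    Topological.class (initial_topology (sval phi : H -> R^o))).

Definition weakly_compact A := compact (A : set weak_topology).

End Hilbert.

Section Curves.
Context {R : realType} {V : normedModType R}.
Implicit Types (D : set R) (f df : R -> V).

(* The derivative is relative to [D]: at an endpoint of an interval it is
   one-sided, and values of [f] outside [D] are irrelevant. *)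
Definition is_derivative_on D f df :=
  forall t, D t -> (s - t)^-1 *: (f s - f t) @[s --> within D t^'] --> df t.

Definition is_C1_on D f df :=
  is_derivative_on D f df /\ {within D, continuous df}.

End Curves.

(* Solutions are taken on the whole of [0, +oo[: for the equations considered
   here these are exactly the maximal solutions. The velocity and acceleration
   [dx], [ddx] are determined by [x] on [0, +oo[. *)
Definition classical_solution {R : realType} {H : normedModType R}
    (gamma : R) (gradPhi gradPsi : H -> H) (eps : R -> R) (x : R -> H) :=
  exists dx ddx : R -> H,
    [/\ is_C1_on `[0, +oo[ x dx, is_C1_on `[0, +oo[ dx ddx &
        forall t : R, 0 <= t ->
          ddx t + gamma *: dx t + gradPhi (x t) + eps t *: gradPsi (x t) = 0].

(* Main.v *)
(** Let [z = xoo], [E = |x'|^2/2 + Phi x + eps (Psi x - m)] with [m <= Psi], and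
    [g = <x', x - z> + gamma/2 |x - z|^2]. The energy [E] is nonincreasing, and
    [g + 3/(2 gamma) E] is nonnegative with derivative at most
    [eps (Psi z - m) - E]; hence [E] tends to 0, and so do [Phi x] and [x'].

    If [|x - z| >= delta], then [<gradPsi x, x - z>] is bounded away from 0 as
    soon as [Phi x] is small: uniform monotonicity bounds it below by
    [theta delta + <gradPsi z, x - z>] on the sphere, and the last term is almost
    nonnegative near [C] by the optimality of [z] and weak compactness of balls,
    used here in the form that nested bounded closed convex sets meet.

    Finally [W = g + E / gamma] satisfies [W' <= - eps <gradPsi x, x - z>] and is
    comparable to [|x - z|^2] up to a multiple of [E]. Since [eps] is not
    integrable, [W] eventually falls below any positive level and cannot climb
    back above it. *)

Require Import Defs.
From HB Require Import structures.
From mathcomp Require Import all_boot all_order all_algebra.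
From mathcomp Require Import all_classical all_reals all_analysis.
From mathcomp Require Import measurable_realfun ring lra.

Set Implicit Arguments.
Unset Strict Implicit.
Unset Printing Implicit Defensive.

Import Order.TTheory GRing.Theory Num.Theory.
Import numFieldNormedType.Exports.

Local Open Scope classical_set_scope.
Local Open Scope ring_scope.

(** * Calculus of the inner product *)

Section InnerProduct.
Context {R : realType} {H : normedModType R} (dot : {dot H for idfun})
  (dot_norm : norm_induced_by dot).
Implicit Types u v w : H.

Lemma dotC u v : dot u v = dot v u.
Proof. by rewrite hermC expr0 mul1r. Qed.

Lemma dotDl u v w : dot (u + v) w = dot u w + dot v w.
Proof. exact: linearDl. Qed.

Lemma dotBl u v w : dot (u - v) w = dot u w - dot v w.
Proof. exact: linearBl. Qed.

Lemma dotDr u v w : dot w (u + v) = dot w u + dot w v.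
Proof. exact: linearD. Qed.

Lemma dotBr u v w : dot w (u - v) = dot w u - dot w v.
Proof. exact: linearB. Qed.

Lemma dotZl a u v : dot (a *: u) v = a * dot u v.
Proof. exact: linearZl_LR. Qed.

Lemma dotZr a u v : dot u (a *: v) = a * dot u v.
Proof. exact: linearZ. Qed.

Lemma normsqD u v : `|u + v| ^+ 2 = `|u| ^+ 2 + 2 * dot u v + `|v| ^+ 2.
Proof. by rewrite !dot_norm dotDl !dotDr (dotC v u); ring. Qed.

Lemma normsqB u v : `|u - v| ^+ 2 = `|u| ^+ 2 - 2 * dot u v + `|v| ^+ 2.
Proof. by rewrite !dot_norm dotBl !dotBr (dotC v u); ring. Qed.

(** Both signs come from expanding the nonnegative squares of [c *: u + v] and [c *: u - v] and
    dividing by [c]. The weight is kept free so that cross terms can be absorbed in different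
    proportions. *)
Lemma dot_young (c : R) u v : 0 < c ->
  `|dot u v| <= (c * `|u| ^+ 2 + c^-1 * `|v| ^+ 2) / 2.
Proof.
move=> c0; have cV : 0 <= c^-1 by rewrite invr_ge0 ltW.
have sqZ : `|c *: u| ^+ 2 = c ^+ 2 * `|u| ^+ 2.
  by rewrite normrZ exprMn real_normK ?num_real.
have cE A d B : c^-1 * (c ^+ 2 * A + 2 * (c * d) + B) = c * A + 2 * d + c^-1 * B.
  by field; rewrite gt_eqF.
have := mulr_ge0 cV (sqr_ge0 `|c *: u + v|).
have := mulr_ge0 cV (sqr_ge0 `|c *: u - v|).
rewrite normsqB normsqD sqZ dotZl -mulrN -mulrN !cE => m p.
by rewrite ler_norml; lra.
Qed.

(** Polarization reduces joint continuity to that of the norm. *)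
Lemma cvg_dot (T : Type) (F : set_system T) (FF : Filter F) (f g : T -> H) u v :
  f @ F --> u -> g @ F --> v -> dot (f s) (g s) @[s --> F] --> dot u v.
Proof.
have dotE a b : dot a b = 4^-1 * (`|a + b| ^+ 2 - `|a - b| ^+ 2).
  by rewrite normsqB normsqD; field.
have sq (h : T -> H) w : h @ F --> w -> `|h s| ^+ 2 @[s --> F] --> `|w| ^+ 2.
  move=> hw; apply: (@continuous_cvg _ R R F _ (fun s => `|h s|) (fun r => r ^+ 2)).
    exact: exprn_continuous.
  exact: cvg_norm.
move=> fu gv; rewrite dotE; under eq_fun do rewrite dotE.
apply: cvgM; first exact: cvg_cst.
by apply: cvgB; apply: sq; [exact: cvgD|exact: cvgB].
Qed.

Lemma is_derive_dot (f g : R -> H) (t : R) df dg :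
  is_derive t 1 f df -> is_derive t 1 g dg ->
  is_derive t 1 (fun s => dot (f s) (g s)) (dot df (g t) + dot (f t) dg).
Proof.
move=> [fd fE] [gd gE].
have gc : {for t, continuous g}.
  exact/differentiable_continuous/derivable1_diffP.
suff : h^-1 *: (dot (f (h *: 1 + t)) (g (h *: 1 + t)) - dot (f t) (g t))
    @[h --> 0^'] --> (dot df (g t) + dot (f t) dg : R).
  by move=> dfg; split; [apply/cvg_ex; eexists; exact: dfg|exact/cvg_lim].
(* Splitting as in the product rule, with [g] at the moved point in the first term; this is where
   the continuity of [g] at [t] enters. *)
have -> : (fun h : R =>
    h^-1 *: (dot (f (h *: 1 + t)) (g (h *: 1 + t)) - dot (f t) (g t))) =
  (fun h => dot (h^-1 *: (f (h *: 1 + t) - f t)) (g (h *: 1 + t)) +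
    dot (f t) (h^-1 *: (g (h *: 1 + t) - g t))).
  apply/funext => h; rewrite dotZl dotZr dotBl dotBr -mulrDr.
  by rewrite -[LHS]/(_ * _); congr (_ * _); ring.
apply: cvgD; apply: cvg_dot.
- by rewrite -fE; exact: fd.
- have sc : h *: 1 + t @[h --> (0 : R)^'] --> t.
    rewrite -[X in _ --> X]add0r -[X in _ --> X + _](mul0r 1).
    apply: cvgD; last exact: cvg_cst.
    by apply: cvgM; [exact: cvg_within|exact: cvg_cst].
  exact: cvg_comp sc gc.
- exact: cvg_cst.
- by rewrite -gE; exact: gd.
Qed.

Lemma is_derive_comp_gradient F gF (c : R -> H) (t : R) dc :
  is_gradient dot F gF -> is_derive t 1 c dc ->
  is_derive t 1 (F \o c) (dot (gF (c t)) dc).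
Proof.
move=> /(_ (c t))[Fd FE] [cd cE].
have cdiff : differentiable c t by exact/derivable1_diffP.
have Fcdiff : differentiable (F \o c) t by exact: differentiable_comp.
split; first exact/derivable1_diffP.
by rewrite deriveE// diff_comp//= FE -cE deriveE.
Qed.

End InnerProduct.

(** * First-order inequalities along segments *)

Section ConvexGradient.
Context {R : realType} {H : normedModType R} (dot : {dot H for idfun}).
Implicit Types (f : H -> R) (gf : H -> H) (x y z : H).

Lemma convex_functionE f (t : R) x y : convex_function [set: H] f ->
  0 <= t -> t <= 1 -> f (t *: x + (1 - t) *: y) <= t * f x + (1 - t) * f y.
Proof.
by move=> cf t0 t1; apply: (cf (Itv01 t0 t1)); rewrite inE.
Qed.

Lemma cvg_gradient f gf x v : is_gradient dot f gf ->
  h^-1 * (f (h *: v + x) - f x) @[h --> 0^'+] --> dot (gf x) v.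
Proof.
move=> /(_ x)[fd fE]; rewrite -fE -deriveE//.
exact/cvg_dnbhs_at_right/(diff_derivable (v := v) fd).
Qed.

(** By convexity, the slopes of [f] from [x] towards [y] with step in ]0, 1] are at most
    [f y - f x]; the bound passes to the limit. *)
Lemma convex_gradient_le f gf x y :
  convex_function [set: H] f -> is_gradient dot f gf ->
  dot (gf x) (y - x) <= f y - f x.
Proof.
move=> cf gradf; apply: (cvgr_to_le (cvg_gradient (x := x) (v := y - x) gradf)).
near=> h.
have h0 : 0 < h by near: h; exact: nbhs_right_gt.
have h1 : h <= 1 by near: h; exact: nbhs_right_le.
rewrite ler_pdivrMl//.
have -> : h *: (y - x) + x = h *: y + (1 - h) *: x.
  by rewrite scalerBr scalerBl scale1r -addrA [- _ + x]addrC.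
have := convex_functionE y x cf (ltW h0) h1; lra.
Unshelve. all: by end_near. Qed.

(** First-order optimality: minimality of [z] makes all slopes along the segment to [y]
    nonnegative. *)
Lemma argmin_gradient_ge0 (C : set H) f gf z y :
  is_gradient dot f gf -> argmin C f z ->
  (forall t : R, 0 <= t -> t <= 1 -> C (t *: y + (1 - t) *: z)) ->
  0 <= dot (gf z) (y - z).
Proof.
move=> gradf [_ zmin] seg; apply: (cvgr_to_ge (cvg_gradient (x := z) (v := y - z) gradf)).
near=> h.
have h0 : 0 < h by near: h; exact: nbhs_right_gt.
have h1 : h <= 1 by near: h; exact: nbhs_right_le.
rewrite mulr_ge0 ?invr_ge0 ?(ltW h0)// subr_ge0; apply: zmin.
have -> : h *: (y - z) + z = h *: y + (1 - h) *: z.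
  by rewrite scalerBr scalerBl scale1r -addrA [- _ + z]addrC.
exact: seg (ltW h0) h1.
Unshelve. all: by end_near. Qed.

End ConvexGradient.

(** * Nested bounded closed convex sets, in the role of weak compactness *)

Section NestedConvex.
Context {R : realType} {H : completeNormedModType R} (dot : {dot H for idfun})
  (dot_norm : norm_induced_by dot).

(* Almost minimal-norm points of the [D n] form a Cauchy sequence, by the
   parallelogram identity at their midpoints. *)
Lemma nested_convex_nonempty (D : nat -> set H) (M : R) :
  (forall n, closed (D n)) ->
  (forall n x y, D n x -> D n y -> D n (2^-1 *: (x + y))) ->
  (forall n m, (n <= m)%N -> D m `<=` D n) ->
  (forall n, D n !=set0) -> (forall n x, D n x -> `|x| <= M) ->
  exists x, forall n, D n x.
Proof.
move=> Dcl Dmid Dnest D0 DM.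
pose A n := [set `|x| ^+ 2 | x in D n].
have Ainf n : has_inf (A n).
  split; first by have [x Dx] := D0 n; exists (`|x| ^+ 2), x.
  by exists 0 => _ [x _ <-]; exact: sqr_ge0.
pose d n := inf (A n).
have dle n x : D n x -> d n <= `|x| ^+ 2.
  by move=> Dx; apply: ge_inf; [exact: (Ainf n).2|exists x].
have dnd : {homo d : n m / (n <= m)%N >-> n <= m}.
  move=> n m nm; apply: lb_le_inf; first exact: (Ainf m).1.
  by move=> _ [x /(Dnest _ _ nm) Dx <-]; exact: dle.
have dub n : d n <= M ^+ 2.
  have [x Dx] := D0 n; apply: le_trans (dle _ _ Dx) _.
  by rewrite ler_sqr ?nnegrE ?(le_trans _ (DM n x Dx))// DM.
have /choice[y yP] n : exists y, D n y /\ `|y| ^+ 2 <= d n + n.+1%:R^-1.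
  have [_ [x Dx <-] xlt] := @inf_adherent _ (A n) n.+1%:R^-1 ltac:(by []) (Ainf n).
  by exists x; split => //; exact: ltW.
pose l := sup (range d).
have rd : has_sup (range d).
  by split; [exists (d 0%N), 0%N|exists (M ^+ 2) => _ [n _ <-]].
have dl n : d n <= l by apply: ub_le_sup; [exact: rd.2|exists n].
(* The midpoint of [y n] and [y m] lies in [D n], so its squared norm is at least [d n]; the
   parallelogram identity then bounds the distance. *)
have ynm n m : (n <= m)%N ->
    `|y n - y m| ^+ 2 <= 4 * (l - d n) + 4 * n.+1%:R^-1.
  move=> nm; have [Dn yn] := yP n; have [Dm ym] := yP m.
  have := dle _ _ (Dmid _ _ _ Dn (Dnest _ _ nm _ Dm)).
  rewrite normrZ exprMn real_normK ?num_real// (normsqB dot_norm) (normsqD dot_norm).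
  have mn : (m.+1%:R^-1 : R) <= n.+1%:R^-1 by rewrite lef_pV2 ?posrE// ler_nat.
  have -> : 2^-1 ^+ 2 = 4^-1 :> R by field.
  have := dl m; have := dl n; move: yn ym mn.
  move: (n.+1%:R^-1) (m.+1%:R^-1) (`|y n| ^+ 2) (`|y m| ^+ 2) (dot _ _) => a b p q r; lra.
have /cauchy_cvgP/cvg_ex[x yx] : cauchy (y @ \oo).
  apply/cauchy_exP => e e0.
  (* Each of the two terms of [ynm] carries a factor 4, hence stays below [e ^+ 2 / 2]. *)
  have e2 : 0 < e ^+ 2 / 8 by rewrite divr_gt0 ?exprn_gt0.
  have [_ [N _ <-] dN] := sup_adherent e2 rd.
  have [K _ KP] := near_infty_natSinv_lt (PosNum e2).
  pose L := maxn N K; exists (y L); exists L => //= m Lm.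
  rewrite -ball_normE /=.
  rewrite -(ltr_pXn2r (n := 2)) ?nnegrE ?(ltW e0)//.
  apply: le_lt_trans (ynm _ _ Lm) _.
  have := dnd _ _ (leq_maxl N K : (N <= L)%N).
  have /= := KP L (leq_maxr _ _); rewrite -/l in dN; move: dN.
  by move: (L.+1%:R^-1) (e ^+ 2) => a b; lra.
exists x => n; apply: (@closed_cvg _ _ _ _ y (D n) (Dcl n) _ x yx).
by exists n => //= m nm; apply: (Dnest _ _ nm); case: (yP m).
Qed.

(** If no [delta] worked, the bad points for [delta] = 1/(n+1) would form nested nonempty bounded
    closed convex sets. A common point would satisfy [F y <= 0] and still violate the sign condition
    on [dot u (y - z)]. *)
Lemma sublevel_halfspace (F : H -> R) (u z : H) (M e : R) :
  convex_function [set: H] F -> continuous F ->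
  (forall y, F y <= 0 -> 0 <= dot u (y - z)) -> 0 < e ->
  exists2 delta, 0 < delta &
    forall y, `|y - z| <= M -> F y <= delta -> - e < dot u (y - z).
Proof.
move=> cF contF u0 e0; apply: contrapT => nodelta.
pose D n := [set y | [/\ `|y - z| <= M, F y <= n.+1%:R^-1 & dot u (y - z) <= - e]].
have cdot : continuous (fun y => dot u (y - z)).
  move=> y; apply: (cvg_dot dot_norm); first exact: cvg_cst.
  by apply: cvgB; [exact: cvg_id|exact: cvg_cst].
have [] := @nested_convex_nonempty D (M + `|z|).
- move=> n; rewrite (_ : D n = [set y | `|y - z| <= M] `&`
    ([set y | F y <= n.+1%:R^-1] `&` [set y | dot u (y - z) <= - e])).
    apply: closedI; last apply: closedI.
    + apply: (closed_comp _ (@closed_le R M)) => y _.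
      by apply: cvg_norm; apply: cvgB; [exact: cvg_id|exact: cvg_cst].
    + by apply: (closed_comp _ (@closed_le R _)) => y _; exact: contF.
    + by apply: (closed_comp _ (@closed_le R _)) => y _; exact: cdot.
  by apply/seteqP; split=> y; [case|case=> ? []].
- move=> n x y [xM xn xe] [yM yn ye].
  have h : 1 - 2^-1 = 2^-1 :> R by field.
  have xyE : 2^-1 *: (x + y) - z = 2^-1 *: (x - z) + 2^-1 *: (y - z).
    rewrite -[RHS]scalerDr (addrACA x) [RHS]scalerDr; congr (_ + _).
    by rewrite scalerDr -scalerDl -[X in _ + X]h addrC subrK scale1r.
  split.
  + rewrite xyE (le_trans (ler_normD _ _))// !normrZ ger0_norm ?invr_ge0//; lra.
  + rewrite scalerDr.
    have := convex_functionE (t := 2^-1) x y cF ltac:(lra) ltac:(lra).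
    by rewrite h; move: xn yn; move: (n.+1%:R^-1) => a; lra.
  + by rewrite xyE dotDr !dotZr; lra.
- move=> n m nm y [yM ym ye]; split=> //; apply: le_trans ym _.
  by rewrite lef_pV2 ?posrE// ler_nat.
- move=> n; apply: contrapT => Dn0; apply: nodelta; exists n.+1%:R^-1 => // y yM yn.
  by rewrite ltNge; apply/negP => ye; apply: Dn0; exists y.
- move=> n y [yM _ _]; rewrite -[y](subrK z) (le_trans (ler_normD _ _))//.
  by rewrite lerD2r.
- move=> y yD.
  have Fy : F y <= 0.
    rewrite leNgt; apply/negP => Fy.
    have [K _ /(_ K (leqnn _))/=] := near_infty_natSinv_lt (PosNum Fy).
    by have [_ + _] := yD K; rewrite leNgt => /negP.
  by have [_ _] := yD 0%N; have := u0 y Fy; lra.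
Qed.

End NestedConvex.

(** * Differential inequalities on the half-line, and comparison of an integral with a series *)

Section RealCalculus.
Context {R : realType}.

(** The ray is a neighbourhood of each [t > 0], so the relative limit there is a two-sided one; what
    remains is the substitution s = t + h. *)
Lemma is_derive_ray (V : normedModType R) (f df : R -> V) (t : R) :
  is_derivative_on `[0, +oo[ f df -> 0 < t -> is_derive t 1 f (df t).
Proof.
move=> fdf t0; have tdf := fdf t ltac:(by rewrite /= in_itv/= ltW).
have {}tdf : (s - t)^-1 *: (f s - f t) @[s --> t^'] --> df t.
  move=> A /tdf At.
  have tD : \forall s \near t^', 0 <= s by apply: nbhs_dnbhs; exact: lt_le_nbhsr.
  suff : \forall s \near t^', A ((s - t)^-1 *: (f s - f t)) by [].
  near=> s; have : [set` `[0, +oo[%R] s by rewrite /= in_itv/= andbT; near: s.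
  by near: s; exact: At.
have hdf : h^-1 *: (f (h *: 1 + t) - f t) @[h --> (0 : R)^'] --> df t.
  move=> A /tdf[e /= e0 tA]; exists e => //= h he h0.
  have := tA (h *: 1 + t); rewrite addrK scaler1; apply.
    by rewrite /= opprD addrCA subrr addr0 -[- h]sub0r.
  by apply: contra_neq h0 => ht; lra.
by split; [apply/cvg_ex; eexists; exact: hdf|exact/cvg_lim].
Unshelve. all: by end_near. Qed.

Lemma derive_le_growth (f df : R -> R) (a b c : R) : a <= b ->
  (forall t : R, a <= t <= b -> is_derive t 1 f (df t)) ->
  (forall t : R, a < t < b -> df t <= c) -> f b - f a <= c * (b - a).
Proof.
rewrite le_eqVlt => /predU1P[->|ab fdf dfc]; first by rewrite !subrr mulr0.
have fc : {within `[a, b], continuous f}.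
  apply: continuous_in_subspaceT => t; rewrite inE/= in_itv/= => /fdf[ft _].
  exact/differentiable_continuous/derivable1_diffP.
have [|t tab ->] := @MVT R f df a b ab _ fc.
  by move=> t; rewrite in_itv/= => /andP[/ltW ? /ltW ?]; apply: fdf; apply/andP.
by rewrite ler_wpM2r ?dfc ?subr_ge0 ?ltW//; move: tab; rewrite in_itv.
Qed.

(** If [E] stayed above some [c > 0], then [G] would eventually decrease at rate at least [c / 2],
    against its lower bound. So [E] gets below every [c], and by monotonicity it remains there. *)
Lemma lyapunov_vanishes (E G dG e : R -> R) (B : R) :
  (forall t : R, 0 < t -> 0 <= E t) ->
  (forall s t : R, 0 < s -> s <= t -> E t <= E s) ->
  (forall t : R, 0 < t -> is_derive t 1 G (dG t)) ->
  (forall t : R, 0 < t -> dG t <= e t - E t) ->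
  (forall t : R, 0 < t -> B <= G t) -> e t @[t --> +oo] --> 0 ->
  E t @[t --> +oo] --> 0.
Proof.
move=> E0 Enoninc GdG dGE GB e0.
have small (c : R) : 0 < c -> exists2 T, 0 < T & E T < c.
  move=> c0; apply: contrapT => large.
  have {}large (t : R) : 0 < t -> c <= E t.
    by move=> t0; rewrite leNgt; apply/negP => Ec; apply: large; exists t.
  have c2 : 0 < c / 2 by lra.
  have [T [_ eT]] : \forall t \near +oo, e t < c / 2 by exact: cvgr_lt c2.
  pose T1 := Num.max T 0 + 1.
  have T1T : T < T1 by rewrite /T1; have := @le_max _ _ T T 0; rewrite lexx /=; lra.
  have T10 : 0 < T1 by rewrite /T1; have := @le_max _ _ 0 T 0; rewrite lexx orbT; lra.
  have GT1 := GB T1 T10.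
  (* Long enough for [G] to fall to [B - 1] or lower. *)
  pose T2 := T1 + (G T1 - B + 1) / (c / 2).
  have T12 : T1 <= T2 by rewrite lerDl divr_ge0//; lra.
  have : G T2 - G T1 <= - (c / 2) * (T2 - T1).
    apply: derive_le_growth T12 _ _ => t /andP[T1t _].
      by apply: GdG; lra.
    have t0 : 0 < t by lra.
    have := dGE t t0; have := large t t0; have := eT t ltac:(lra); lra.
  have -> : - (c / 2) * (T2 - T1) = - (G T1 - B + 1).
    by rewrite /T2; field; rewrite gt_eqF.
  by have := GB T2 ltac:(lra); lra.
apply/cvgr0Pnorm_lt => c c0; have [T T0 ET] := small c c0.
exists T; split; first exact: num_real.
move=> t /ltW Tt; rewrite ger0_norm ?E0 ?(lt_le_trans T0)//.
exact: le_lt_trans (Enoninc _ _ T0 Tt) ET.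
Qed.

(** Let [s] be the last time in [a, b] with [W s <= l]. After [s] the function exceeds [l], hence
    cannot increase, so [W b <= W s]. *)
Lemma derive_barrier (W dW : R -> R) (a b l : R) : a <= b ->
  (forall t : R, a <= t <= b -> is_derive t 1 W (dW t)) ->
  (forall t : R, a <= t <= b -> l <= W t -> dW t <= 0) ->
  W a <= l -> W b <= l.
Proof.
move=> ab WdW dW0 Wa; rewrite leNgt; apply/negP => Wb.
pose A := [set t | a <= t <= b /\ W t <= l].
have supA : has_sup A.
  by split; [exists a; split; rewrite ?lexx|exists b => t [/andP[]]].
pose s := sup A.
have as_ : a <= s by apply: ub_le_sup; [exact: supA.2|split; rewrite ?lexx].
have sb : s <= b by apply: ge_sup; [exact: supA.1|move=> t [/andP[]]].
have Wc : {for s, continuous W}.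
  have [Ws _] := WdW s ltac:(by rewrite as_).
  exact/differentiable_continuous/derivable1_diffP.
(* The supremum is attained: otherwise continuity would give [W > l] on a whole neighbourhood of
   [s]. *)
have Ws : W s <= l.
  rewrite leNgt; apply/negP => Wsl.
  have [e /= e0 eW] : \forall t \near s, l < W t by exact: (cvgr_gt _ Wc).
  have [t [tab Wt] st] := sup_adherent e0 supA.
  have ts : t <= s by apply: ub_le_sup; [exact: supA.2|].
  suff : l < W t by rewrite ltNge Wt.
  by apply: eW; rewrite -/s in st; rewrite /= ger0_norm; lra.
suff : W b - W s <= 0 * (b - s) by lra.
apply: derive_le_growth sb _ _ => t /andP[st tb].
  by apply: WdW; apply/andP; split; lra.
apply: dW0; first by apply/andP; split; lra.
rewrite leNgt; apply/negP => Wt.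
suff : t <= s by lra.
by apply: ub_le_sup; [exact: supA.2|split; [apply/andP; split|]; lra].
Qed.

(** On each unit interval the integral is at most the value at the left endpoint, so bounded partial
    sums would make the integral finite. *)
Lemma nonincreasing_integral_sum (f : R -> R) (N : nat) (B : R) :
  (forall t : R, 0 <= t -> 0 <= f t) ->
  (forall s t : R, 0 <= s -> s <= t -> f t <= f s) ->
  (\int[lebesgue_measure]_(t in `[0%R, +oo[%classic) (f t)%:E = +oo)%E ->
  exists n, B < \sum_(i < n) f (N + i.+1)%:R.
Proof.
move=> f0 fnoninc; apply: contraPP => bounded; apply/eqP; rewrite lt_eqF//.
have {}bounded n : \sum_(i < n) f (N + i.+1)%:R <= B.
  by rewrite leNgt; apply/negP => ?; apply: bounded; exists n.
pose F (k : nat) : set R := `[k%:R, k.+1%:R[%classic.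
have FE : `[0%R, +oo[%classic = \bigcup_k F k :> set R.
  apply/seteqP; split => [t /=|t [k _]]; rewrite /F /= !in_itv/= ?andbT.
    move=> t0; exists (Num.truncn t) => //=; rewrite in_itv/=.
    exact: truncn_itv.
  by move=> /andP[kt _]; apply: le_trans kt.
have Fge0 k t : F k t -> 0 <= t.
  by rewrite /F/= in_itv/= => /andP[kt _]; apply: le_trans kt.
have fmeas : measurable_fun (`[0%R, +oo[%classic : set R) (EFin \o f).
  apply/measurable_EFinP.
  (* Monotonicity is known on the nonnegative reals only; freezing [f] at its value in 0 on the
     negative side makes it monotone on the whole line. *)
  apply: (eq_measurable_fun (fun t : R => f (Num.max 0 t))).
    by move=> t; rewrite inE/= in_itv/= andbT => t0; rewrite max_r.
  apply: nonincreasing_measurable => // s t st.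
  by apply: fnoninc; [rewrite le_max lexx|rewrite ge_max !le_max lexx st orbT].
have Fsub k : F k `<=` `[0%R, +oo[%classic.
  by move=> t /Fge0 t0; rewrite /= in_itv/= t0.
have Fmeas k : measurable (F k) by exact: measurable_itv.
have Fint k : (\int[lebesgue_measure]_(t in F k) (f t)%:E <= (f k%:R)%:E)%E.
  apply: (@le_trans _ _ (\int[lebesgue_measure]_(t in F k) (cst (f k%:R)%:E t))%E).
    apply: ge0_le_integral.
    - exact: Fmeas.
    - by move=> t /Fge0 t0; rewrite lee_fin f0.
    - exact: measurable_funS fmeas.
    - exact: measurable_cst.
    - move=> t; rewrite /F/= in_itv/= => /andP[kt _].
      by rewrite lee_fin fnoninc.
  rewrite integral_cst/=; last exact: Fmeas.
  rewrite /F lebesgue_measure_itv/= lte_fin ltr_nat ltnSn.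
  by rewrite -EFinB -natrB// subSnn mule1.
rewrite FE ge0_integral_bigcup//; last 3 first.
- by rewrite -FE.
- by move=> t [k _ /Fge0 t0]; rewrite lee_fin f0.
- apply/trivIsetP => i j _ _ ij; apply/seteqP; split => // t [].
  rewrite /F /= !in_itv/= => /andP[it ti] /andP[jt tj].
  have := le_lt_trans it tj; have := le_lt_trans jt ti.
  by rewrite !ltr_nat !ltnS => ji ij'; move: ij; rewrite eqn_leq ji ij'.
(* The shifted sums start at [N.+1], so the indices 0 to [N] are counted apart. *)
apply: (@le_lt_trans _ _ (\sum_(i < N.+1) f i%:R + B)%:E); last exact: ltry.
apply: lime_le.
  apply: is_cvg_nneseries => k _ _; apply: integral_ge0 => t /Fge0 t0.
  by rewrite lee_fin f0.
exists N.+1 => // n /= /subnKC <-; move: (n - N.+1)%N => m.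
apply: (@le_trans _ _ (\sum_(0 <= k < N.+1 + m) (f k%:R)%:E)%E).
  by apply: lee_sum => k _; exact: Fint.
rewrite sumEFin lee_fin big_mkord big_split_ord/= lerD2l.
by apply: le_trans (bounded m); apply: ler_sum => i _; rewrite addSnnS.
Qed.

Lemma derive_le0_of_nonincreasing (f : R -> R) (t df : R) :
  0 < t -> (forall s r : R, 0 <= s -> s <= r -> f r <= f s) ->
  is_derive t 1 f df -> df <= 0.
Proof.
move=> t0 fnoninc [fd <-].
apply: (cvgr_to_le (cvg_dnbhs_at_right fd)); near=> h.
have h0 : 0 < h by near: h; exact: nbhs_right_gt.
have ft : f (h *: 1 + t) <= f t.
  by apply: fnoninc; [exact: ltW|rewrite scaler1 lerDr ltW].
by rewrite /= -[leLHS]/(_ * _) pmulr_rle0 ?invr_gt0// subr_le0.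
Unshelve. all: by end_near. Qed.

(** While above [l], [W] loses at least [alpha] times a term of a divergent series per unit of time,
    which its nonnegativity forbids forever. Once at or below [l], it stays there by
    [derive_barrier]. *)
Lemma eventually_below_barrier (W dW eps : R -> R) (T : nat) (l alpha : R) :
  0 < alpha ->
  (forall t : R, T%:R <= t -> is_derive t 1 W (dW t)) ->
  (forall t : R, T%:R <= t -> 0 <= W t) ->
  (forall t : R, T%:R <= t -> l <= W t -> dW t <= - (alpha * eps t)) ->
  (forall t : R, 0 <= t -> 0 <= eps t) ->
  (forall s t : R, 0 <= s -> s <= t -> eps t <= eps s) ->
  (\int[lebesgue_measure]_(t in `[0%R, +oo[%classic) (eps t)%:E = +oo)%E ->
  exists2 t0, T%:R <= t0 & forall t : R, t0 <= t -> W t <= l.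
Proof.
move=> alpha0 WdW W0 dWl eps0 epsn epsint.
have [t0 Tt0 Wt0] : exists2 t0, T%:R <= t0 & W t0 <= l.
  apply: contrapT => above.
  have {}above (t : R) : T%:R <= t -> l <= W t.
    move=> Tt; rewrite leNgt; apply/negP => Wl; apply: above.
    by exists t => //; exact: ltW.
  have [n] := nonincreasing_integral_sum T (W T%:R / alpha) eps0 epsn epsint.
  rewrite ltr_pdivrMr// ltNge => /negP; apply.
  suff : W (T + n)%:R <= W T%:R - (\sum_(i < n) eps (T + i.+1)%:R) * alpha.
    have := W0 (T + n)%:R; rewrite ler_nat leq_addr => /(_ isT); lra.
  elim: n => [|n IH]; first by rewrite addn0 big_ord0 mul0r subr0.
  have nS : (T + n)%:R + 1 = (T + n.+1)%:R :> R by rewrite addnS natr1.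
  have Tn : T%:R <= (T + n)%:R :> R by rewrite ler_nat leq_addr.
  rewrite big_ord_recr/=.
  (* On a unit interval the nonincreasing [eps] is smallest at the right endpoint, whence the
     shifted index of the series. *)
  have : W (T + n.+1)%:R - W (T + n)%:R <=
      - (alpha * eps (T + n.+1)%:R) * ((T + n.+1)%:R - (T + n)%:R).
    apply: derive_le_growth; first by rewrite ler_nat leq_add2l.
      by move=> t /andP[nt _]; apply: WdW; apply: le_trans nt.
    move=> t /andP[/ltW nt /ltW tn]; have Tt := le_trans Tn nt.
    apply: le_trans (dWl t Tt (above t Tt)) _.
    by rewrite lerN2 ler_pM2l// epsn// (le_trans _ Tt).
  rewrite -nS addrAC subrr add0r mulr1 nS; lra.
exists t0 => // t t0t; apply: (@derive_barrier W dW t0 t) => //.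
- by move=> s /andP[t0s _]; apply: WdW; apply: le_trans t0s.
- move=> s /andP[t0s _] ls; have Ts := le_trans Tt0 t0s.
  apply: le_trans (dWl s Ts ls) _.
  by rewrite oppr_le0 mulr_ge0 ?(ltW alpha0)// eps0// (le_trans _ Ts).
Qed.

End RealCalculus.

(* Outside the [delta]-ball, monotonicity along the ray from [z] reduces the
   bound to the sphere, where convexity keeps [Phi] small. *)
Lemma gradient_gap (R : realType) (H : completeNormedModType R)
    (dot : {dot H for idfun}) (dot_norm : norm_induced_by dot)
    (Phi Psi : H -> R) (gradPhi gradPsi : H -> H) (z : H) (delta : R) :
  convex_function [set: H] Phi -> is_gradient dot Phi gradPhi ->
  is_gradient dot Psi gradPsi -> uniformly_monotone dot gradPsi ->
  (forall y, 0 <= Phi y) -> argmin (Phi @^-1` [set 0]) Psi z -> 0 < delta ->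
  exists alpha kappa, [/\ 0 < alpha, 0 < kappa & forall y, Phi y <= kappa ->
    delta <= `|y - z| -> alpha <= dot (gradPsi y) (y - z)].
Proof.
move=> Phic gPhi gPsi [theta [theta0 theta_cvg0 thetaP]] Phi0 zS d0.
have Phiz : Phi z = 0 by case: zS.
have td : 0 < theta delta.
  rewrite lt_neqAle theta0 ?ltW// andbT eq_sym; apply/eqP => td0.
  (* If [theta delta] vanished, the hypothesis on [theta] applied to the constant sequence [delta]
     would force [delta = 0]. *)
  have dcvg : (fun=> delta) @ \oo --> (0 : R).
    apply: theta_cvg0 => [_|]; first exact: ltW.
    by rewrite td0; exact: cvg_cst.
  have d0' : delta = 0.
    exact: (@cvg_unique R (@Rhausdorff R) ((fun=> delta) @ \oo) _ _ _ (cvg_cst _) dcvg).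
  by move: d0; rewrite d0' ltxx.
have Phicont : continuous Phi.
  by move=> y; apply: differentiable_continuous; have [] := gPhi y.
have e0 : 0 < theta delta / 2 by lra.
have [kappa k0 kP] : exists2 kappa, 0 < kappa &
    forall y, `|y - z| <= delta -> Phi y <= kappa ->
      - (theta delta / 2) < dot (gradPsi z) (y - z).
  (* Here [y] is a zero of [Phi]; by convexity so is the whole segment to [z], and the optimality of
     [z] applies along it. *)
  apply: (sublevel_halfspace dot_norm) => // y Phiy.
  apply: (argmin_gradient_ge0 gPsi zS) => t t0 t1; apply/eqP.
  rewrite eq_le Phi0 andbT.
  apply: le_trans (convex_functionE _ _ Phic t0 t1) _.
  by rewrite Phiz mulr0 addr0 mulr_ge0_le0.
exists (theta delta / 2), kappa; split => // y yk dy.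
have rho0 : 0 < `|y - z| by exact: lt_le_trans dy.
(* With this ratio, [w] is the point where the segment from [z] to [y] meets the sphere of radius
   [delta]. *)
pose r := delta / `|y - z|.
have r0 : 0 < r by rewrite divr_gt0.
have r1 : r <= 1 by rewrite ler_pdivrMr// mul1r.
pose w := r *: y + (1 - r) *: z.
have wz : w - z = r *: (y - z).
  by rewrite /w scalerBl scale1r scalerBr addrA addrAC addrK.
have yw : y - w = (1 - r) *: (y - z).
  by rewrite [RHS]scalerBl scale1r -wz opprB addrA subrK.
have nwz : `|w - z| = delta.
  by rewrite wz normrZ gtr0_norm// /r divfK ?gt_eqF.
have Phiw : Phi w <= kappa.
  apply: le_trans (convex_functionE _ _ Phic (ltW r0) r1) _.
  rewrite Phiz mulr0 addr0; apply: le_trans yk.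
  by rewrite ler_piMl.
have := kP w ltac:(by rewrite nwz) Phiw.
have := thetaP w z; rewrite nwz wz !dotZr dotBl => h1 h2.
have h3 : 0 <= (1 - r) * (dot (gradPsi y) (y - z) - dot (gradPsi w) (y - z)).
  by rewrite -dotBl -dotZr -yw (le_trans _ (thetaP y w))// theta0.
have h4 : theta delta / 2 < r * dot (gradPsi w) (y - z) by lra.
have A0 : 0 < dot (gradPsi w) (y - z).
  by rewrite -(pmulr_rgt0 _ r0); apply: lt_trans h4.
have h5 : r * dot (gradPsi w) (y - z) <= dot (gradPsi w) (y - z).
  by rewrite ler_piMl// ltW.
(* The factor [1 - r] in [h3] can be cancelled only if [r < 1]; for [r = 1] the points [w] and [y]
   coincide. *)
move: r1; rewrite le_eqVlt => /predU1P[r1|r1].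
  by move: h4; rewrite /w r1 subrr scale0r scale1r addr0 mul1r => /ltW.
by move: h3; rewrite pmulr_rge0 ?subr_gt0// subr_ge0; lra.
Qed.

(** * Energy estimates and strong convergence of the trajectory *)

Theorem theorem3p1 (R : realType) (H : completeNormedModType R)
    (dot : {dot H for idfun}) (dot_norm : norm_induced_by dot)
    (gamma : R) (gamma_gt0 : 0 < gamma)
    (Phi Psi : H -> R) (gradPhi gradPsi : H -> H)
    (eps deps : R -> R)
    (C := argmin [set: H] Phi) (S := argmin C Psi)
    (* (a) *)
    (Phi_convex : convex_function [set: H] Phi)
    (Phi_grad : is_gradient dot Phi gradPhi)
    (Phi_lip : lipschitz_on_bounded gradPhi)
    (C_zero : C = Phi @^-1` [set 0]) (C_neq0 : C !=set0)
    (* (b) *)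
    (Psi_convex : convex_function [set: H] Psi)
    (Psi_grad : is_gradient dot Psi gradPsi)
    (Psi_lip : lipschitz_on_bounded gradPsi)
    (Psi_lb : exists m : R, forall x, m <= Psi x)
    (* (c) *)
    (S_neq0 : S !=set0)
    (* (d) *)
    (eps_gt0 : forall t : R, 0 <= t -> 0 < eps t)
    (eps_noninc : forall s t : R, 0 <= s -> s <= t -> eps t <= eps s)
    (eps_C1 : is_C1_on `[0, +oo[ eps deps)
    (eps_cvg0 : eps t @[t --> +oo] --> (0 : R))
    (deps_cvg0 : deps t @[t --> +oo] --> (0 : R))
    (* (H1) *)
    (eps_int : (\int[lebesgue_measure]_(t in `[0%R, +oo[%classic) (eps t)%:E = +oo)%E)
    (Psi_unif : uniformly_monotone dot gradPsi)
    (xoo : H) (xooS : S xoo)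
    (cases :
      (* (i) *)
      weakly_compact [set x | dot (gradPsi x) (x - xoo) <= 0] \/
      (* (ii): (H2) and (H3) *)
      ((forall p, multiplier_cone dot C gradPsi p ->
         (\int[lebesgue_measure]_(t in `[0%R, +oo[%classic)
            (fenchel_conjugate dot Phi (eps t *: p)
             - support_function dot C (eps t *: p)) < +oo)%E) /\
       (exists2 k : R, 0 < k &
         \forall t \near +oo, 0 <= - deps t <= k * eps t ^+ 2)))
    (x : R -> H) (x_sol : classical_solution gamma gradPhi gradPsi eps x) :
  `|x t - xoo| @[t --> +oo] --> (0 : R).
Proof.
have Phi0 y : 0 <= Phi y.
  have [z zC] := C_neq0.
  have Phiz : Phi z = 0 by move: zC; rewrite C_zero.
  by rewrite -Phiz; case: zC => _; apply.
have zS : argmin (Phi @^-1` [set 0]) Psi xoo by rewrite -C_zero.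
have Phiz : Phi xoo = 0 by case: zS.
have [m Psim] := Psi_lb.
have [dx [ddx [[xdx _] [dxddx _] ode]]] := x_sol.
have [epsdeps _] := eps_C1.
pose v t := dot (dx t) (dx t).
pose N t := dot (x t - xoo) (x t - xoo).
pose E t := 2^-1 * v t + Phi (x t) + eps t * (Psi (x t) - m).
pose g t := dot (dx t) (x t - xoo) + gamma / 2 * N t.
pose a t := dot (gradPsi (x t)) (x t - xoo).
have v0 t : 0 <= v t by rewrite /v -dot_norm sqr_ge0.
have N0 t : 0 <= N t by rewrite /N -dot_norm sqr_ge0.
have xD (t : R) : 0 < t -> is_derive t 1 x (dx t) by exact: is_derive_ray.
have dxD (t : R) : 0 < t -> is_derive t 1 dx (ddx t) by exact: is_derive_ray.
have epsD (t : R) : 0 < t -> is_derive t 1 eps (deps t) by exact: is_derive_ray.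
have xzD (t : R) : 0 < t -> is_derive t 1 (fun s => x s - xoo) (dx t).
  move=> t0; have := is_deriveB (xD t t0) (is_derive_cst xoo t 1).
  by rewrite subr0.
have deps0 (t : R) : 0 < t -> deps t <= 0.
  by move=> t0; apply: derive_le0_of_nonincreasing t0 eps_noninc (epsD t t0).
have ddxE (t : R) u : 0 < t -> dot (ddx t) u =
    - (gamma * dot (dx t) u + dot (gradPhi (x t)) u + eps t * dot (gradPsi (x t)) u).
  move=> /ltW/ode/(congr1 (fun w => dot w u)).
  by rewrite !dotDl !dotZl linear0l; lra.
pose dE t := 2^-1 * (dot (ddx t) (dx t) + dot (dx t) (ddx t)) +
  dot (gradPhi (x t)) (dx t) +
  (eps t * dot (gradPsi (x t)) (dx t) + (Psi (x t) - m) * deps t).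
have ED (t : R) : 0 < t -> is_derive t 1 E (dE t).
  move=> t0; rewrite /dE.
  have vD := is_derive_dot dot_norm (dxD t t0) (dxD t t0).
  have PhiD := is_derive_comp_gradient Phi_grad (xD t t0).
  have PsiD := is_derive_comp_gradient Psi_grad (xD t t0).
  have PsimD := is_deriveB PsiD (is_derive_cst m t 1).
  have := is_deriveD (is_deriveD (is_deriveZ 2^-1 vD) PhiD)
    (is_deriveM (epsD t t0) PsimD).
  by rewrite subr0.
(* Substituting the equation cancels both gradient terms; besides friction only
   [(Psi (x t) - m) * deps t] is left, which is nonpositive. *)
have dEle (t : R) : 0 < t -> dE t <= - gamma * v t.
  move=> t0; rewrite /dE (dotC dot (dx t)) (ddxE _ _ t0) -/(v t).
  have : (Psi (x t) - m) * deps t <= 0.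
    by rewrite mulr_ge0_le0 ?deps0// subr_ge0.
  lra.
have PsiE t : 0 <= t -> 0 <= eps t * (Psi (x t) - m).
  by move=> t0; rewrite mulr_ge0 ?subr_ge0// ltW// eps_gt0.
have E0 (t : R) : 0 < t -> 0 <= E t.
  move=> t0; have := v0 t; have := Phi0 (x t); have := PsiE t (ltW t0).
  by rewrite /E; lra.
have vE (t : R) : 0 < t -> v t <= 2 * E t.
  by move=> t0; have := Phi0 (x t); have := PsiE t (ltW t0); rewrite /E; lra.
have PhiE (t : R) : 0 < t -> Phi (x t) <= E t.
  by move=> t0; have := v0 t; have := PsiE t (ltW t0); rewrite /E; lra.
have Enoninc (s t : R) : 0 < s -> s <= t -> E t <= E s.
  move=> s0 st; suff : E t - E s <= 0 * (t - s) by lra.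
  apply: derive_le_growth st _ _ => r /andP[sr _].
    by apply: ED; apply: lt_le_trans sr.
  apply: le_trans (dEle r (lt_trans s0 sr)) _.
  by rewrite mulNr oppr_le0 mulr_ge0 ?(ltW gamma_gt0).
pose dg t := v t - dot (gradPhi (x t)) (x t - xoo) - eps t * a t.
have gD (t : R) : 0 < t -> is_derive t 1 g (dg t).
  move=> t0.
  have ND := is_derive_dot dot_norm (xzD t t0) (xzD t t0).
  have dxxD := is_derive_dot dot_norm (dxD t t0) (xzD t t0).
  have gD := is_deriveD dxxD (is_deriveZ (gamma / 2) ND).
  apply: (is_derive_eq gD).
  rewrite -[_ *: _]/(_ * _) (ddxE _ _ t0) (dotC dot (x t - xoo)) -/(v t) -/(a t) /dg.
  by field.
have Phia t : Phi (x t) <= dot (gradPhi (x t)) (x t - xoo).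
  have := convex_gradient_le (x t) xoo Phi_convex Phi_grad.
  by rewrite Phiz !dotBr; lra.
have Psia t : Psi (x t) - Psi xoo <= a t.
  have := convex_gradient_le (x t) xoo Psi_convex Psi_grad.
  by rewrite /a !dotBr; lra.
(* Young's inequality with weight [gamma^-1] uses up exactly the term [gamma / 2 * N t] of [g]. *)
have gE (t : R) : 0 < t -> - (E t / gamma) <= g t.
  move=> t0.
  have := @dot_young R H dot dot_norm gamma^-1 (dx t) (x t - xoo).
  rewrite invr_gt0 invrK !dot_norm -/(v t) -/(N t) ler_norml => /(_ gamma_gt0)/andP[dlow _].
  have : gamma^-1 * v t <= gamma^-1 * (2 * E t) by rewrite ler_pM2l ?invr_gt0 ?vE.
  by rewrite /g; lra.
(* The weight [2 / gamma] spends only half of that term, leaving a multiple of [N t] on both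
   sides. *)
have gN (t : R) : 0 < t ->
    gamma / 4 * N t - 2 * (E t / gamma) <= g t <= 3 / 4 * gamma * N t + 2 * (E t / gamma).
  move=> t0; have c0 : 0 < 2 / gamma by rewrite divr_gt0.
  have := @dot_young R H dot dot_norm (2 / gamma) (dx t) (x t - xoo) c0.
  rewrite invf_div !dot_norm -/(v t) -/(N t) ler_norml => /andP[dlow dup].
  have : gamma^-1 * v t <= gamma^-1 * (2 * E t) by rewrite ler_pM2l ?invr_gt0 ?vE.
  by rewrite /g => ?; apply/andP; split; lra.
have E_cvg0 : E t @[t --> +oo] --> (0 : R).
  (* The factor turns the [v t] in [dg t] into [- v t / 2], the kinetic part of [- E t]; the
     convexity bounds [Phia] and [Psia] supply the rest. *)
  pose G t := g t + 3 / (2 * gamma) * E t.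
  pose e t := eps t * (Psi xoo - m).
  apply: (@lyapunov_vanishes R E G (fun t => dg t + 3 / (2 * gamma) * dE t) e 0) => //.
  - by move=> t t0; exact: is_deriveD (gD t t0) (is_deriveZ _ (ED t t0)).
  - move=> t t0.
    have : 3 / (2 * gamma) * dE t <= 3 / (2 * gamma) * (- gamma * v t).
      by rewrite ler_pM2l ?dEle// divr_gt0// mulr_gt0.
    have -> : 3 / (2 * gamma) * (- gamma * v t) = - (3 / 2) * v t.
      by field; rewrite gt_eqF.
    have : eps t * (Psi (x t) - Psi xoo) <= eps t * a t.
      by rewrite ler_pM2l; [exact: Psia|exact/eps_gt0/ltW].
    by have := Phia t; rewrite /dg /e /E; lra.
  - move=> t t0; rewrite /G.
    have -> : 3 / (2 * gamma) * E t = E t / gamma + 2^-1 * (E t / gamma).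
      by field; rewrite gt_eqF.
    have : 0 <= E t / gamma by rewrite divr_ge0 ?E0 ?(ltW gamma_gt0).
    by have := gE t t0; lra.
  - rewrite -(mul0r (Psi xoo - m)); apply: cvgM => //; exact: cvg_cst.
(* The coefficient is just enough to cancel [v t] in the derivative, and by [gE] to keep [W]
   nonnegative. *)
pose W t := g t + gamma^-1 * E t.
pose dW t := dg t + gamma^-1 * dE t.
have WD (t : R) : 0 < t -> is_derive t 1 W (dW t).
  by move=> t0; exact: is_deriveD (gD t t0) (is_deriveZ _ (ED t t0)).
have W0 (t : R) : 0 < t -> 0 <= W t by move=> /gE; rewrite /W; lra.
have dWle (t : R) : 0 < t -> dW t <= - (eps t * a t).
  move=> t0.
  have : gamma^-1 * dE t <= gamma^-1 * (- gamma * v t).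
    by rewrite ler_pM2l ?dEle ?invr_gt0.
  rewrite mulrA mulrN mulVf ?gt_eqF// mulN1r.
  by have := Phi0 (x t); have := Phia t; rewrite /dW /dg; lra.
apply/cvgr0Pnorm_lt => c c0.
(* Once [E t / gamma < eta / 6], the bounds [gN] show that [W t >= eta] forces [N t] above
   [c ^+ 2 / 24], hence above [(c / 5) ^+ 2], while [W t <= eta] forces [N t] below
   [7 / 24 * c ^+ 2]. *)
pose eta := gamma * c ^+ 2 / 16.
have c20 : 0 < c ^+ 2 by rewrite exprn_gt0.
have eta0 : 0 < eta by rewrite divr_gt0// mulr_gt0.
have d0 : 0 < c / 5 by rewrite divr_gt0.
have [alpha [kappa [alpha0 kappa0 gap]]] :=
  gradient_gap dot_norm Phi_convex Phi_grad Psi_grad Psi_unif Phi0 zS d0.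
have m0 : 0 < Num.min kappa (gamma * (eta / 6)).
  by rewrite lt_min kappa0 mulr_gt0// divr_gt0.
have [T [Treal ET]] : \forall t \near +oo, E t < Num.min kappa (gamma * (eta / 6)).
  exact: cvgr_lt m0.
(* A natural number, since the barrier argument sums over integer times, and positive, since
   derivatives are two-sided only away from 0. *)
pose T1 := (Num.truncn `|T|).+1.
have T1T (t : R) : T1%:R <= t ->
    [/\ 0 < t, E t < kappa & E t / gamma < eta / 6].
  move=> T1t; have TT1 : `|T| < T1%:R by exact: truncnS_gt.
  have t0 : 0 < t by apply: lt_le_trans T1t; rewrite ltr0n.
  have := ET t (le_lt_trans (ler_norm T) (lt_le_trans TT1 T1t)).
  by rewrite lt_min ltr_pdivrMr// mulrC => /andP[? ?]; split; rewrite // mulrC.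
have [t0 T1t0 Wt0] : exists2 t0, T1%:R <= t0 & forall t, t0 <= t -> W t <= eta.
  apply: (@eventually_below_barrier R W dW eps T1 eta alpha) => //.
  - by move=> t /T1T[t0 _ _]; exact: WD.
  - by move=> t /T1T[t0 _ _]; exact: W0.
  - move=> t /T1T[t0 Ek Eeta] Weta; apply: le_trans (dWle t t0) _.
    rewrite lerN2 mulrC ler_pM2l; [apply: gap|exact/eps_gt0/ltW].
      by rewrite (le_trans (PhiE t t0))// ltW.
    rewrite -(ler_pXn2r (n := 2)) ?nnegrE ?(ltW d0)// dot_norm -/(N t).
    have /andP[_ gup] := gN t t0.
    have : gamma * (c ^+ 2 / 24) <= gamma * N t by rewrite /W /eta in Weta Eeta *; lra.
    by rewrite ler_pM2l// expr_div_n; lra.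
  - by move=> t t0; exact/ltW/eps_gt0.
exists t0; split; first exact: num_real.
move=> t /ltW t0t; rewrite normr_id.
have [tgt0 _ Eeta] := T1T t (le_trans T1t0 t0t).
rewrite -(ltr_pXn2r (n := 2)) ?nnegrE ?(ltW c0)// dot_norm -/(N t).
have /andP[glow _] := gN t tgt0.
have := Wt0 t t0t; rewrite -[N t < _](ltr_pM2l gamma_gt0).
by rewrite /W /eta in Eeta *; have := mulr_gt0 gamma_gt0 c20; lra.
Qed.
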